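(* Let $\alpha:[0,1]\to[0,\infty)$ be continuous on $[0,1]$ and $C^\infty$ on $(0,1]$, monotone, with $\alpha(0)=0$, $\lim_{s\to0^+}\alpha'(s)=\infty$ and $\alpha''<0$. Let $\sigma\in C^1([0,\infty))$ be a given function with values in $[0,1]$ satisfying, for some $z_0>0$, $$\sigma(z)=1\ \text{ for } z\in[0,z_0],\qquad \sigma'(z)\le 0 .$$ Then there exist $\gamma>0$ and a solution $\phi\in L^1([0,\infty))$ of $$-\gamma\phi(x)-\gamma\phi'(x)x=\phi(x)\int_0^x\alpha(\sigma(y))\phi(y)\,dy-\alpha(\sigma(x))\phi(x)\int_x^\infty\phi(y)\,dy,$$ which has a Pareto tail.
   Context: A function $\phi$ has a Pareto tail if there exist constants $k,\theta>0$ such that $\lim_{z\to\infty}\frac{\int_z^\infty\phi(y)\,dy}{z^{-1/\theta}}=k$. *)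

(* Defs.v *)
From mathcomp Require Import all_boot all_order all_algebra.
From mathcomp Require Import all_classical all_reals all_analysis.

Set Implicit Arguments.
Unset Strict Implicit.
Unset Printing Implicit Defensive.

Import Order.TTheory GRing.Theory Num.Theory.
Import numFieldNormedType.Exports.

Local Open Scope classical_set_scope.
Local Open Scope ring_scope.

(* Derivatives relative to an interval A of the real line: only points of A
   enter the difference quotient. This is the usual derivative at interior
   points of A, and the one-sided derivative at an endpoint belonging to A. *)
Definition diff_quotient (R : realType) (f : R -> R) (x y : R) : R :=
  (f y - f x) / (y - x).

Definition derivable_on (R : realType) (A : set R) (f : R -> R) (x : R) : Prop :=
  cvg (diff_quotient f x y @[y --> within A x^']).

Definition derive_on (R : realType) (A : set R) (f : R -> R) (x : R) : R :=
  lim (diff_quotient f x y @[y --> within A x^']).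

Definition C1_on (R : realType) (A : set R) (f : R -> R) : Prop :=
  (forall x, A x -> derivable_on A f x) /\ {within A, continuous (derive_on A f)}.

Definition smooth_on (R : realType) (A : set R) (f : R -> R) : Prop :=
  forall (n : nat) x, A x -> derivable_on A (iter n (derive_on A) f) x.

Definition monotone_on (R : realType) (A : set R) (f : R -> R) : Prop :=
  (forall x y, A x -> A y -> x <= y -> f x <= f y) \/
  (forall x y, A x -> A y -> x <= y -> f y <= f x).

Definition integrable_on (R : realType) (A : set R) (f : R -> R) : Prop :=
  (@lebesgue_measure R).-integrable A (EFin \o f).

Definition has_pareto_tail (R : realType) (phi : R -> R) : Prop :=
  exists k theta : R, [/\ 0 < k, 0 < theta &
    (\int[@lebesgue_measure R]_(y in `[z, +oo[) phi y) / z `^ (- theta^-1)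
      @[z --> +oo] --> k].

(* Classical (pointwise) solution on the closed half-line. *)
Definition is_solution (R : realType) (alpha sigma : R -> R) (gamma : R)
    (phi : R -> R) : Prop :=
  forall x : R, 0 <= x ->
    derivable_on `[0, +oo[ phi x /\
    - gamma * phi x - gamma * derive_on `[0, +oo[ phi x * x =
      phi x * (\int[@lebesgue_measure R]_(y in `[0, x]) (alpha (sigma y) * phi y))
      - alpha (sigma x) * phi x *
        (\int[@lebesgue_measure R]_(y in `[x, +oo[) phi y).

(* Main.v *)
Require Import Defs.
From mathcomp Require Import all_boot all_order all_algebra.
From mathcomp Require Import all_classical all_reals all_analysis.
From mathcomp Require Import measurable_realfun.
From mathcomp Require Import ring lra.
Import Order.TTheory GRing.Theory Num.Theory.
Import numFieldNormedType.Exports.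
Local Open Scope classical_set_scope.
Local Open Scope ring_scope.

(** Put [gamma = alpha 1], [b = alpha (sigma _) / alpha 1],
    [F x = \int_x^oo phi] and [G x = \int_0^x b phi].  The right-hand side of
    the equation is [- gamma (F G)'] and the left-hand side is
    [- gamma (x phi)'], so that, with both sides vanishing at 0, the equation
    reduces to [x phi = F G].  Normalize [F 0 = 1].

    Write [phi = F h] with the hazard rate [h], i.e.,
    [F = exp (- \int_0^x h)].  Then the equation says [x h = G], a fixed-point
    equation for [h] alone.  Where [b = 1], that is on [[0, z0]], one has
    [G = 1 - F] and the equation is the logistic equation in [ln x], solved by
    [h = 1 / (x + z0)]; prescribing [h] on [[0, z0]] avoids the division by [x]
    at 0.  Beyond [z0] the map [h |-> G / x] reduces distances by one half or
    more in the norm [sup |h x| / x^2] ([step_contract]); it preserves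
    [0 <= x h <= 1] because [G <= \int_0^x phi = 1 - F <= 1].  Its iterates
    therefore converge pointwise, dominated convergence shows that the limit is
    a fixed point, and a fixed point is automatically continuous ([exists_fixed_point]).

    For the tail, [G] increases to some [p > 0], and
    [L = ln F + p ln x] satisfies [L' = (p - G) / x >= 0].  Since
    [p - G x <= F x] and [F' = - F G / x <= - F / (2 x)] beyond [z0], the
    function [L + 2 F] is nonincreasing, so [L] is bounded and converges, which
    says that [F x / x^(-p)] tends to a positive constant ([surv_tail]). *)

(** * Auxiliary facts on limits and real functions *)

Lemma cvg_near_eq {T : Type} {U : topologicalType} {F : set_system T}
    {FF : Filter F} (f g : T -> U) (l : U) :
  (\forall x \near F, f x = g x) -> f @ F --> l -> g @ F --> l.
Proof. by move=> fg; apply: cvg_trans; exact: near_eq_cvg. Qed.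

Section calculus.
Set Implicit Arguments.
Unset Strict Implicit.
Context {R : realType}.

Lemma expRN_lip (u v : R) : 0 <= u -> 0 <= v ->
  `|expR (- u) - expR (- v)| <= `|u - v|.
Proof.
wlog uv : u v / u <= v.
  move=> wlog u0 v0; have [uv|/ltW vu] := leP u v; first exact: wlog.
  by rewrite distrC [leRHS]distrC; exact: wlog.
move=> u0 v0; rewrite ger0_norm ?subr_ge0 ?ler_expR ?lerN2//.
rewrite ler0_norm ?subr_le0// opprB.
have -> : expR (- u) - expR (- v) = expR (- u) * (1 - expR (- (v - u))).
  by rewrite mulrBr mulr1 -expRD; congr (_ - expR _); ring.
have h1 := expR_ge1Dx (- (v - u)).
have h2 : expR (- u) <= 1 by rewrite -expR0 ler_expR oppr_le0.
have h3 : expR (- (v - u)) <= 1 by rewrite -expR0 ler_expR oppr_le0 subr_ge0.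
rewrite (@le_trans _ _ (1 - expR (- (v - u))))//.
  by rewrite ler_piMl// subr_ge0.
by rewrite lerBlDr -lerBlDl; move: h1; rewrite opprB; lra.
Qed.

Lemma is_derive_nondecreasing (f df : R -> R) (a : R) :
  (forall x, a <= x -> is_derive x 1 f (df x)) ->
  (forall x, a <= x -> 0 <= df x) ->
  forall x y, a <= x -> x <= y -> f x <= f y.
Proof.
move=> fdf df0 x y; apply: ger0_derive1_ndecry => [t|t|].
- by rewrite in_itv/= andbT => /ltW at_; have [] := fdf _ at_.
- rewrite in_itv/= andbT => /ltW at_; rewrite derive1E.
  by have [_ ->] := fdf _ at_; exact: df0.
- apply: continuous_in_subspaceT => t; rewrite inE/= in_itv/= andbT => at_.
  apply: differentiable_continuous; apply/derivable1_diffP.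
  by have [] := fdf _ at_.
Qed.

(** The increments are dominated by a geometric series, so their
    telescoping series converges absolutely. *)
Lemma geometric_cvg (u : nat -> R) c :
  (forall n, `|u n.+1 - u n| <= c * 2^-1 ^+ n) -> cvgn u.
Proof.
move=> uc.
have -> : u = (fun n => u 0%N + series (telescope u) n).
  by apply/funext => n; exact: eq_sum_telescope.
apply: is_cvgD; first exact: is_cvg_cst.
apply: (@normed_cvg _ R^o).
apply: (series_le_cvg _ _ uc) => [n|n|].
- exact: normr_ge0.
- exact: le_trans (uc n).
- by apply: is_cvg_geometric_series; rewrite ger0_norm// invf_lt1// ltr1n.
Qed.
End calculus.

(** * Integrals from 0 as functions of the upper bound *)

Section primitive.
Set Implicit Arguments.
Unset Strict Implicit.
Context {R : realType}.
Notation mu := (@lebesgue_measure R).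
Implicit Types (f g : R -> R) (x y c : R).

Definition prim f x : R := \int[mu]_(t in `[0, x]) f t.

Definition loc_int f := forall x, mu.-integrable `[0, x] (EFin \o f).

Lemma continuous_loc_int f : continuous f -> loc_int f.
Proof.
move=> cf x; apply: continuous_compact_integrable; first exact: segment_compact.
exact: continuous_subspaceT.
Qed.

Lemma bounded_loc_int f c : measurable_fun setT f ->
  (forall x, `|f x| <= c) -> loc_int f.
Proof.
move=> mf fc x; apply: measurable_bounded_integrable => //.
- exact/compact_finite_measure/segment_compact.
- exact: measurable_funTS.
- exists c; split => [|d cd y _]; first exact: num_real.
  exact: (le_trans (fc y) (ltW cd)).
Qed.

Lemma eq_prim f g x : (forall y, 0 <= y <= x -> f y = g y) ->
  prim f x = prim g x.
Proof.
move=> fg; apply: eq_Rintegral => y; rewrite inE/= in_itv/= => yx.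
exact: fg.
Qed.

Lemma prim_le0 f x : x <= 0 -> prim f x = 0.
Proof.
rewrite le_eqVlt => /predU1P[->|x0]; rewrite /prim.
  by rewrite set_itv1 Rintegral_set1.
by rewrite set_itv_ge ?Rintegral_set0// bnd_simp -ltNge.
Qed.

Lemma prim_ge0 f x : (forall y, 0 <= y <= x -> 0 <= f y) -> 0 <= prim f x.
Proof.
by move=> f0; apply: Rintegral_ge0 => y /=; rewrite in_itv/=; exact: f0.
Qed.

Lemma le_prim f g x : loc_int f -> loc_int g ->
  (forall y, 0 <= y <= x -> f y <= g y) -> prim f x <= prim g x.
Proof.
move=> lf lg fg; apply: le_Rintegral => // y /=; rewrite in_itv/=; exact: fg.
Qed.

Lemma primB f g x : loc_int f -> loc_int g ->
  prim (fun y => f y - g y) x = prim f x - prim g x.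
Proof. by move=> lf lg; apply: RintegralB. Qed.

Lemma primZ f c x : loc_int f -> prim (fun y => c * f y) x = c * prim f x.
Proof. by move=> lf; apply: RintegralZl. Qed.

Lemma loc_intB f g : loc_int f -> loc_int g -> loc_int (fun y => f y - g y).
Proof.
move=> lf lg x.
rewrite (_ : _ \o _ = (EFin \o f) \- (EFin \o g))%E//; exact: integrableB.
Qed.

Lemma loc_intZ f c : loc_int f -> loc_int (fun y => c * f y).
Proof.
move=> lf x; rewrite (_ : _ \o _ = (fun y => c%:E * (f y)%:E)%E)//.
exact: integrableZl.
Qed.

Lemma ler_norm_primB f g k x : loc_int f -> loc_int g -> loc_int k ->
  (forall y, 0 <= y <= x -> `|f y - g y| <= k y) ->
  `|prim f x - prim g x| <= prim k x.
Proof.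
move=> lf lg lk fgk; rewrite -primB// ler_norml; apply/andP; split.
  rewrite -[leLHS]mulN1r -primZ//; apply: le_prim => [||y yx].
  - exact: loc_intZ.
  - exact: loc_intB.
  - by rewrite mulN1r; have /ler_normlW := fgk _ yx; have := fgk _ yx;
      rewrite ler_norml => /andP[].
apply: le_prim => // [|y yx]; first exact: loc_intB.
exact: ler_normlW (fgk _ yx).
Qed.

Lemma prim_continuous f : loc_int f -> continuous (prim f).
Proof.
move=> lf; have lr b : 0 < b -> {in `]0, b[, continuous (prim f)} /\
    prim f @ 0^'+ --> prim f 0.
  move=> b0; have := @parameterized_integral_continuous R 0 b f (ltW b0) (lf b).
  by move/(continuous_within_itvP _ b0) => [].
move=> x; have [x0|x0|->] := ltgtP x 0.
- rewrite /continuous_at (prim_le0 f (ltW x0)).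
  have : \forall y \near x, 0 = prim f y.
    by near=> y; rewrite prim_le0// ltW//; near: y; exact: lt_nbhsl.
  by move/cvg_near_eq; apply; exact: cvg_cst.
- have x1 : 0 < x + 1 by rewrite addr_gt0.
  apply: (lr (x + 1) x1).1; rewrite in_itv/= x0/=; lra.
- apply/left_right_continuousP; split; last exact: (lr 1 ltr01).2.
  rewrite (prim_le0 f (lexx 0)).
  have : \forall y \near 0^'-, 0 = prim f y.
    by near=> y; rewrite prim_le0//; near: y; exact: nbhs_left_le.
  by move/cvg_near_eq; apply; exact: cvg_cst.
Unshelve. all: by end_near. Qed.

Lemma is_derive_prim f x : continuous f -> 0 < x ->
  is_derive x 1 (prim f) (f x).
Proof.
move=> cf x0; have x1 : x < x + 1 by rewrite ltrDl.
have [df fE] := continuous_FTC1_closed x1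
  (continuous_loc_int cf (x + 1)) x0 (cf x).
by apply: DeriveDef; [exact: df|rewrite -derive1E; exact: fE].
Qed.

(** Continuity and differentiability are needed on the closed and the open
    half-line only, so that [g] may fail to be smooth at 0, as functions
    of [prim f] do, being constant to the left of 0. *)
Lemma prim_FTC2 f g x : continuous f -> {for 0, continuous g} ->
  (forall y, 0 < y -> is_derive y 1 g (f y)) -> 0 <= x ->
  prim f x = g x - g 0.
Proof.
move=> cf cg0 dg; rewrite le_eqVlt => /predU1P[<-|x0].
  by rewrite prim_le0// subrr.
have cgx : {for x, continuous g}.
  apply: differentiable_continuous; apply/derivable1_diffP.
  by have [] := dg _ x0.
rewrite /prim /Rintegral (@continuous_FTC2 _ f g)//.
- exact: continuous_subspaceT.
- split => [y||].
  + by rewrite in_itv/= => /andP[y0 _]; have [] := dg _ y0.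
  + exact: cvg_at_right_filter.
  + exact: cvg_at_left_filter.
- move=> y; rewrite in_itv/= => /andP[y0 _].
  by rewrite derive1E; have [] := dg _ y0.
Qed.

Lemma nondecreasing_prim f : continuous f -> (forall y, 0 <= y -> 0 <= f y) ->
  {homo prim f : x y / x <= y}.
Proof.
move=> cf f0 x y xy; have [x0|x0] := leP x 0.
  by rewrite (prim_le0 _ x0) prim_ge0// => z /andP[z0 _]; exact: f0.
rewrite -subr_ge0 /prim (@Rintegral_itvB _ f (BLeft 0) (BRight y) x).
- apply: Rintegral_ge0 => z /=; rewrite in_itv/= => /andP[xz _].
  exact/f0/ltW/(lt_trans x0 xz).
- exact: continuous_loc_int.
- by rewrite bnd_simp ltW.
- by rewrite bnd_simp.
Qed.

(** Dominated convergence, the dominating function being a constant. *)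
Lemma prim_cvg (u : nat -> R -> R) f c x :
  (forall n, measurable_fun setT (u n)) ->
  (forall n y, `|u n y| <= c) ->
  (forall y, u ^~ y @ \oo --> f y) ->
  prim (u n) x @[n --> \oo] --> prim f x.
Proof.
move=> mu_ uc uf.
have mf : measurable_fun setT f.
  by apply: (@measurable_fun_cvg _ _ _ _ u) => // y _; exact: uf.
have lc : loc_int (cst c) by apply: continuous_loc_int => y; exact: cvg_cst.
have [||||||_ _] := @dominated_convergence _ _ R mu `[0, x]%classic _
  (fun n => EFin \o u n) (EFin \o f) (EFin \o cst c).
- exact: measurable_itv.
- by move=> n; apply/measurable_EFinP/measurable_funTS; exact: mu_.
- by apply/measurable_EFinP; exact: measurable_funTS.
- by apply: aeW => y _; apply: cvg_EFin; [exact: nearW|exact: uf].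
- exact: lc.
- by apply: aeW => y n _ /=; rewrite lee_fin.
have fin : (\int[mu]_(t in `[0%R, x]) (f t)%:E)%E \is a fin_num.
  apply: integrable_fin_num => //; apply: bounded_loc_int mf _ x => y.
  by apply: (cvgr_to_le (cvg_norm (uf y))); exact: nearW.
rewrite -(fineK fin) => /fine_cvg; exact.
Qed.

Lemma prim_sqr d x : 0 <= x -> prim (fun y => d * y ^+ 2) x = d * x ^+ 3 / 3.
Proof.
move=> x0; pose g y : R := d * y ^+ 3 / 3.
have dg y : is_derive y 1 g (d * y ^+ 2).
  by rewrite /g; apply: is_derive_eq; rewrite /GRing.scale/=; field.
transitivity (g x - g 0); last by rewrite /g; field.
apply: (@prim_FTC2 _ g x _ _ _ x0).
- by move=> y; apply: cvgM; [exact: cvg_cst|exact: exprn_continuous].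
- apply: differentiable_continuous; apply/derivable1_diffP.
  by have [] := dg 0.
Qed.

End primitive.

(** * Derivatives relative to an interval *)

Section relative_derivative.
Set Implicit Arguments.
Unset Strict Implicit.
Context {R : realType}.
Implicit Types (A : set R) (f g : R -> R) (x d : R).

(** Properness is what makes a limit along this filter unique, hence
    what turns convergence of the difference quotients into a value of
    [derive_on]. *)
Lemma within_punctured_proper A x :
  (forall e, 0 < e -> exists y, [/\ A y, y != x & `|y - x| < e]) ->
  ProperFilter (within A x^').
Proof.
move=> Ax; split; last exact: within_filter.
rewrite /within/= => -[e /= e0 eA]; have [y [Ay yx ye]] := Ax _ e0.
by apply: (eA y) => //=; rewrite distrC.
Qed.

(** Comparing with a function [g] differentiable in the usual sense at
    [x] covers the endpoints of [A], where [g] is an extension of [f] beyond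
    [A].  Caratheodory's form of differentiability of [g] provides a continuous
    function that agrees with the relative difference quotient of [f]. *)
Lemma cvg_diff_quotient A f g x d : is_derive x 1 g d -> f x = g x ->
  (\forall y \near x, A y -> f y = g y) ->
  diff_quotient f x y @[y --> within A x^'] --> d.
Proof.
move=> /is_derive1_caratheodory[q [gq cq qx]] fgx fg.
apply: (@cvg_near_eq _ _ _ _ q).
  rewrite near_withinE near_withinE; apply: filterS fg => y fg yx Ay.
  by rewrite /diff_quotient fgx fg// gq mulfK// subr_eq0.
rewrite -qx; apply: cvg_within_filter; apply: cvg_within_filter; exact: cq.
Qed.

Lemma derivable_on_continuous A f x : derivable_on A f x ->
  f @ within A (nbhs x) --> f x.
Proof.
move=> /cvg_ex[l fl].
have fx : f @ within A x^' --> f x.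
  apply: (@cvg_near_eq _ _ _ _ (fun y => f x + diff_quotient f x y * (y - x))).
    rewrite near_withinE near_withinE; apply: nearW => y yx _.
    by rewrite /diff_quotient divfK ?subr_eq0// addrC subrK.
  have <- : f x + l * 0 = f x by rewrite mulr0 addr0.
  apply: cvgD; first by rewrite mulr0 addr0; exact: cvg_cst.
  apply: cvgM; first exact: fl.
  apply: cvg_within_filter; apply: cvg_within_filter.
  have : (y - x) @[y --> x] --> x - x.
    by apply: cvgB; [exact: cvg_id|exact: cvg_cst].
  by rewrite subrr.
move=> V Vfx; have := fx _ Vfx; rewrite !nbhs_simpl/= /within/= => h.
change (nbhs x (fun y => A y -> V (f y))).
change (nbhs x (fun y => y != x -> A y -> V (f y))) in h.
apply: filterS h => y h Ay; have [->|yx] := eqVneq y x.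
  exact: nbhs_singleton Vfx.
exact: h.
Qed.

Lemma continuous_comp_within A f g : {within A, continuous f} ->
  continuous g -> (forall x, A (g x)) -> continuous (f \o g).
Proof.
move=> /subspace_continuousP cf cg Ag x V Vfx.
have := cf _ (Ag x) _ Vfx; rewrite !nbhs_simpl/= /within/= => h.
have := cg x _ h; rewrite !nbhs_simpl/= => h'.
change (nbhs x (fun y => V (f (g y)))).
by apply: filterS h' => y; apply; exact: Ag.
Qed.

(** * The coefficient at 1 *)

(** The infinite slope at 0 excludes the zero function.  A nonincreasing
    nonnegative function that starts at 0 is zero, so [alpha] is nondecreasing,
    and then [alpha 1 = 0] would make it zero as well. *)
Lemma alpha1_gt0 (alpha : R -> R) :
  (forall s, 0 <= s <= 1 -> 0 <= alpha s) ->
  monotone_on `[0, 1] alpha -> alpha 0 = 0 ->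
  derive_on `]0, 1] alpha s @[s --> 0^'+] --> +oo ->
  0 < alpha 1 /\ forall s, 0 <= s <= 1 -> alpha s <= alpha 1.
Proof.
move=> al_ge0 al_mono al0 dal.
have nonzero : ~ forall s, 0 <= s <= 1 -> alpha s = 0.
  move=> alE; have /cvgryPge/(_ 1) dge1 := dal.
  have never : \forall s \near (0:R)^'+, False.
    near=> s.
    have s0 : 0 < s by near: s; exact: nbhs_right_gt.
    have s1 : s < 1 by near: s; exact: nbhs_right_lt.
    have : 1 <= derive_on `]0, 1] alpha s by near: s; exact: dge1.
    have pf : ProperFilter (within (`]0, 1]%classic : set R) s^').
      apply: within_punctured_proper => e e0.
      exists (Num.max (s / 2) (s - e / 2)); split.
      - rewrite /= in_itv/= lt_max ge_max.
        apply/andP; split; [|apply/andP; split].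
        + by rewrite divr_gt0.
        + lra.
        + lra.
      - by rewrite lt_eqF// gt_max; apply/andP; split; lra.
      - rewrite ltr_norml; apply/andP; split; last first.
          by rewrite ltrBlDr gt_max; apply/andP; split; lra.
        by rewrite ltrBrDr lt_max; apply/orP; right; lra.
    rewrite /derive_on.
    have -> :
        lim (diff_quotient alpha s y @[y --> within `]0, 1]%classic s^']) = 0.
      apply/cvg_lim => //; apply: (@cvg_diff_quotient _ _ (cst 0)).
      - by rewrite alE// !ltW.
      - apply: (@nearW _ (nbhs s)) => y /=; rewrite in_itv/= => /andP[y0 y1].
        by rewrite alE// y1 ltW.
    by rewrite ler10.
  by have [] := @filter_ex _ _ (at_right_proper_filter (0 : R)) _ never.
have al_le s : 0 <= s <= 1 -> alpha s <= alpha 1.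
  case: al_mono => [al_nd|al_ni] s01.
    have /andP[s0 s1] := s01.
    by apply: al_nd => //=; rewrite in_itv/= ?lexx ?ler01.
  exfalso; apply: nonzero => t t01; apply/eqP; rewrite eq_le al_ge0// andbT.
  have /andP[t0 t1] := t01; rewrite -al0.
  by apply: al_ni => //=; rewrite in_itv/= ?lexx ?ler01.
split => //; rewrite lt_neqAle al_ge0 ?ler01 ?lexx// andbT eq_sym.
apply/eqP => al1; apply: nonzero => t t01; apply/eqP.
by rewrite eq_le al_ge0// andbT -al1 al_le.
Unshelve. all: by end_near. Qed.

End relative_derivative.

(** * Construction of the hazard rate *)

Section fixed_point.
Set Implicit Arguments.
Unset Strict Implicit.
Context {R : realType} (b : R -> R) (z0 : R).
Hypotheses (b_cont : continuous b) (b01 : forall x, 0 <= b x <= 1).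
Hypotheses (z0_gt0 : 0 < z0) (b1 : forall x, 0 <= x <= z0 -> b x = 1).
Implicit Types (h k : R -> R) (x y : R).

(** The survival function of the law on the half-line with hazard rate
    [h]. *)
Definition surv h x := expR (- prim h x).

Definition dens h x := surv h x * h x.

Definition gain h := prim (fun y => b y * dens h y).

(** The hazard rate of the solution for [b = 1], of density
    [z0 / (x + z0) ^+ 2].  Truncating at 0 makes it continuous on the whole
    line. *)
Definition init_rate x := (Num.max x 0 + z0)^-1.

(** Beyond [z0] this is the map whose fixed points solve
    [x * h x = gain h x].  On [[0, z0]] that equation is singular at 0, and the
    solution is prescribed. *)
Definition step h x := if x <= z0 then init_rate x else gain h x / x.

(** This set of hazard rates is preserved by [step]; together its
    conditions bound [h] by [z0^-1]. *)
Definition admissible h := [/\ forall x, x <= z0 -> h x = init_rate x,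
  forall x, 0 <= h x & forall x, x * h x <= 1].

Lemma max0_gt0 x : 0 < Num.max x 0 + z0.
Proof. by rewrite ltr_wpDl// le_max lexx orbT. Qed.

Lemma init_rate_continuous : continuous init_rate.
Proof.
move=> x; apply: cvgV; first by rewrite gt_eqF// max0_gt0.
apply: cvgD; last exact: cvg_cst.
by apply: (@continuous_max _ _ id (cst 0)); [exact: cvg_id|exact: cvg_cst].
Qed.

Lemma admissible_init : admissible init_rate.
Proof.
split => // x; first by rewrite invr_ge0 ltW// max0_gt0.
rewrite ler_pdivrMr ?max0_gt0// mul1r (@le_trans _ _ (Num.max x 0))//.
  by rewrite le_max lexx.
by rewrite lerDl ltW.
Qed.

Lemma admissible_le h x : admissible h -> `|h x| <= z0^-1.
Proof.
move=> [h1 h0 h2]; rewrite ger0_norm//; have [xz|zx] := leP x z0.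
  rewrite h1// lef_pV2 ?posrE ?max0_gt0//.
  by rewrite lerDr le_max lexx orbT.
have x0 : 0 < x by exact: lt_trans zx.
rewrite (@le_trans _ _ x^-1)//; last by rewrite lef_pV2 ?posrE// ltW.
by rewrite -[leRHS]mul1r ler_pdivlMr// mulrC.
Qed.

Lemma admissible_loc_int h : measurable_fun setT h -> admissible h -> loc_int h.
Proof.
by move=> mh ah; apply: (bounded_loc_int mh) => x; exact: admissible_le.
Qed.

Lemma surv_gt0 h x : 0 < surv h x. Proof. exact: expR_gt0. Qed.

Lemma surv_le1 h x : admissible h -> surv h x <= 1.
Proof. by move=> [_ h0 _]; rewrite -expR0 ler_expR oppr_le0 prim_ge0. Qed.

Lemma surv0 h : surv h 0 = 1.
Proof. by rewrite /surv prim_le0// oppr0 expR0. Qed.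

Lemma surv_continuous h : loc_int h -> continuous (surv h).
Proof.
move=> lh x; apply: continuous_comp; last exact: continuous_expR.
by apply: continuousN; exact: prim_continuous.
Qed.

Lemma dens_ge0 h x : admissible h -> 0 <= dens h x.
Proof. by move=> [_ h0 _]; rewrite mulr_ge0// ltW// surv_gt0. Qed.

Lemma dens_le h x : admissible h -> dens h x <= z0^-1.
Proof.
move=> rh; rewrite /dens -[leRHS]mul1r ler_pM//.
- exact/ltW/surv_gt0.
- by case: rh.
- exact: surv_le1.
- by apply: le_trans (admissible_le x rh); exact: ler_norm.
Qed.

Lemma bdens_le h x : admissible h -> `|b x * dens h x| <= z0^-1.
Proof.
move=> rh; have /andP[b0 bl] := b01 x.
have d0 := dens_ge0 x rh; rewrite (ger0_norm (mulr_ge0 b0 d0)).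
by rewrite -[leRHS]mul1r; apply: ler_pM => //; exact: dens_le.
Qed.

Lemma dens_measurable h : measurable_fun setT h -> admissible h ->
  measurable_fun setT (fun y => b y * dens h y).
Proof.
move=> mh rh; apply: measurable_funM.
  exact: continuous_measurable_fun.
apply: measurable_funM => //; apply: continuous_measurable_fun.
exact/surv_continuous/admissible_loc_int.
Qed.

Lemma bdens_loc_int h : measurable_fun setT h -> admissible h ->
  loc_int (fun y => b y * dens h y).
Proof.
move=> mh rh; apply: (@bounded_loc_int _ _ z0^-1).
  exact: dens_measurable.
by move=> x; exact: bdens_le.
Qed.

Lemma is_derive_surv h x : continuous h -> 0 < x ->
  is_derive x 1 (surv h) (- dens h x).
Proof.
move=> ch x0; have dP := is_derive_prim ch x0.
have dN : is_derive x 1 (- prim h) (- h x) by exact: is_deriveN.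
have := @is_derive1_comp _ expR (- prim h) x _ _ (is_derive_expR _) dN.
by rewrite mulrN.
Qed.

Lemma prim_dens h x : continuous h -> 0 <= x -> prim (dens h) x = 1 - surv h x.
Proof.
move=> ch x0; have cs : continuous (surv h).
  exact/surv_continuous/continuous_loc_int.
have -> : 1 - surv h x = - surv h x - - surv h 0.
  by rewrite surv0 opprK addrC.
apply: (@prim_FTC2 _ (dens h) (- surv h) x _ _ _ x0).
- by move=> y; apply: cvgM; [exact: cs|exact: ch].
- by apply: cvgN; exact: cs.
- move=> y y0; rewrite -[dens h y]opprK; apply: is_deriveN.
  exact: is_derive_surv.
Qed.

Lemma admissible_surv h x : admissible h -> 0 <= x <= z0 ->
  surv h x = z0 / (x + z0).
Proof.
move=> [h1 _ _] /andP[x0 xz].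
rewrite /surv (@eq_prim _ _ init_rate); last first.
  by move=> y /andP[_ yx]; apply: h1; exact: le_trans xz.
have xz0 : 0 < x + z0 by rewrite ltr_wpDl.
have -> : prim init_rate x = ln (x + z0) - ln (0 + z0); last first.
  by rewrite add0r opprB expRD lnK ?posrE// expRN lnK ?posrE.
have dln y : 0 <= y -> is_derive y 1 (fun t => ln (t + z0)) (y + z0)^-1.
  move=> y0; have yz0 : 0 < y + z0 by rewrite ltr_wpDl.
  have d1 : is_derive y 1 (fun t => t + z0) (1 + 0) by exact: is_deriveD.
  have := @is_derive1_comp _ (@ln R) (fun t => t + z0) y _ _
    (is_derive1_ln yz0) d1.
  by rewrite addr0 mulr1.
apply: (@prim_FTC2 _ _ (fun y => ln (y + z0))) => //.
- exact: init_rate_continuous.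
- apply: differentiable_continuous; apply/derivable1_diffP.
  by have [] := dln 0 (lexx 0).
- by move=> y y0; rewrite /init_rate (max_idPl (ltW y0)); exact/dln/ltW.
Qed.

Lemma admissible_dens h x : admissible h -> 0 <= x <= z0 ->
  dens h x = z0 / (x + z0) ^+ 2.
Proof.
move=> rh xz; rewrite /dens admissible_surv//; have [h1 _ _] := rh.
have /andP[x0 xz1] := xz.
by rewrite h1// /init_rate (max_idPl x0) expr2 invfM mulrA.
Qed.

Lemma admissible_gain h x : admissible h -> 0 <= x <= z0 ->
  gain h x = x / (x + z0).
Proof.
move=> rh /andP[x0 xz].
rewrite /gain (@eq_prim _ _ (dens init_rate)); last first.
  move=> y /andP[y0 yx]; have yz : 0 <= y <= z0 by rewrite y0 (le_trans yx).
  by rewrite b1// mul1r !admissible_dens//; exact: admissible_init.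
rewrite prim_dens//; last exact: init_rate_continuous.
rewrite admissible_surv ?x0//; last exact: admissible_init.
by field; rewrite gt_eqF// ltr_wpDl.
Qed.

Lemma gain_ge0 h x : admissible h -> 0 <= gain h x.
Proof.
move=> rh; apply: prim_ge0 => y _.
by have /andP[b0 _] := b01 y; rewrite mulr_ge0// dens_ge0.
Qed.

Lemma gain_le1 h x : continuous h -> admissible h -> 0 <= x -> gain h x <= 1.
Proof.
move=> ch rh x0; have mh : measurable_fun setT h.
  exact: continuous_measurable_fun.
rewrite (@le_trans _ _ (prim (dens h) x))//.
  apply: le_prim => [||y _]; first exact: bdens_loc_int.
    apply: continuous_loc_int => y; apply: cvgM; last exact: ch.
    exact/surv_continuous/continuous_loc_int.
  by have /andP[_ bl] := b01 y; rewrite ler_piMl// dens_ge0.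
by rewrite prim_dens// lerBlDr lerDl ltW// surv_gt0.
Qed.

(** The two branches of [step] agree on [`]0, z0]], since there
    [gain h x = x / (x + z0)] for every admissible [h].  This overlap is what
    makes [step h] continuous at [z0]. *)
Lemma stepE h x : admissible h -> 0 < x -> step h x = gain h x / x.
Proof.
move=> rh x0; rewrite /step; case: ifPn => // xz.
rewrite admissible_gain ?(ltW x0)// /init_rate (max_idPl (ltW x0)).
by field; rewrite !gt_eqF// addr_gt0.
Qed.

(** Measurability of [h] suffices: [step h] depends on [h] through
    integrals.  Applied to a pointwise limit of iterates, this gives the
    continuity of the fixed point. *)
Lemma step_continuous h : measurable_fun setT h -> admissible h ->
  continuous (step h).
Proof.
move=> mh rh x; have [xz|zx] := ltP x z0.
  rewrite /continuous_at {2}/step (ltW xz).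
  apply: (@cvg_near_eq _ _ _ _ init_rate); last exact: init_rate_continuous.
  by near=> y; rewrite /step ifT// ltW//; near: y; exact: lt_nbhsl.
have x0 : 0 < x by exact: lt_le_trans zx.
rewrite /continuous_at stepE//.
apply: (@cvg_near_eq _ _ _ _ (fun y => gain h y / y)).
  by near=> y; rewrite stepE//; near: y; exact: lt_nbhsr.
apply: cvgM; first exact/prim_continuous/bdens_loc_int.
by apply: cvgV; [rewrite gt_eqF|exact: cvg_id].
Unshelve. all: by end_near. Qed.

Lemma admissible_step h : continuous h -> admissible h -> admissible (step h).
Proof.
move=> ch rh; have [i1 i2 i3] := admissible_init; split => x.
- by move=> xz; rewrite /step xz.
- rewrite /step; case: ifPn => [_|]; first exact: i2.
  rewrite -ltNge => zx; rewrite divr_ge0// ?gain_ge0//.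
  exact: ltW (lt_trans z0_gt0 zx).
- rewrite /step; case: ifPn => [_|]; first exact: i3.
  rewrite -ltNge => zx; have x0 := lt_trans z0_gt0 zx.
  by rewrite mulrC divfK ?gt_eqF// gain_le1// ltW.
Qed.

(** The weight [y ^+ 2] is chosen for the constants: integrating it twice
    in [dens h - dens k] and in the gain costs [(1 + 1/3) / 3 = 4/9 < 1/2].
    The product [surv * h] is Lipschitz because [y * k y <= 1] absorbs the
    extra factor [y] that appears when integrating [h - k] in the exponent. *)
Lemma gain_contract h k d x : measurable_fun setT h -> measurable_fun setT k ->
  admissible h -> admissible k -> 0 <= d ->
  (forall y, `|h y - k y| <= d * y ^+ 2) ->
  0 <= x -> `|gain h x - gain k x| <= d / 2 * x ^+ 3.
Proof.
move=> mh mk rh rk d0 hk x0.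
have lq (c : R) : loc_int (fun y => c * y ^+ 2).
  apply: continuous_loc_int => y.
  by apply: cvgM; [exact: cvg_cst|exact: exprn_continuous].
have sle y : 0 <= y -> `|surv h y - surv k y| <= d * y ^+ 3 / 3.
  move=> y0; have [_ h0 _] := rh; have [_ k0 _] := rk.
  apply: (le_trans (expRN_lip (prim_ge0 (fun t _ => h0 t))
    (prim_ge0 (fun t _ => k0 t)))).
  rewrite -prim_sqr//; apply: ler_norm_primB => //; exact: admissible_loc_int.
have dle y : 0 <= y -> `|dens h y - dens k y| <= d * 4 / 3 * y ^+ 2.
  move=> y0; have [_ k0 kl] := rk.
  have -> : dens h y - dens k y =
      surv h y * (h y - k y) + (surv h y - surv k y) * k y.
    by rewrite /dens; ring.
  apply: le_trans (ler_normD _ _) _; rewrite !normrM.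
  rewrite (ger0_norm (ltW (surv_gt0 h y))) (ger0_norm (k0 y)).
  have t1 : surv h y * `|h y - k y| <= d * y ^+ 2.
    by apply: le_trans (hk y); rewrite ler_piMl// surv_le1.
  have t2 : `|surv h y - surv k y| * k y <= d * y ^+ 2 / 3.
    apply: (@le_trans _ _ (d * y ^+ 3 / 3 * k y)).
      by rewrite ler_wpM2r// sle.
    have -> : d * y ^+ 3 / 3 * k y = d * y ^+ 2 / 3 * (y * k y) by field.
    by rewrite ler_piMr// !mulr_ge0// exprn_ge0.
  have -> : d * 4 / 3 * y ^+ 2 = d * y ^+ 2 + d * y ^+ 2 / 3 by field.
  exact: lerD.
apply: (@le_trans _ _ (d * 4 / 3 * x ^+ 3 / 3)); last first.
  have : 0 <= d * x ^+ 3 by rewrite mulr_ge0// exprn_ge0.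
  by nra.
rewrite -prim_sqr//; apply: ler_norm_primB => [|||y /andP[y0 _]].
- exact: bdens_loc_int.
- exact: bdens_loc_int.
- exact: lq.
have /andP[b0 bl] := b01 y.
rewrite -mulrBr normrM ger0_norm//; apply: le_trans (dle y y0).
by rewrite ler_piMl.
Qed.

Lemma step_contract h k d : measurable_fun setT h -> measurable_fun setT k ->
  admissible h -> admissible k -> 0 <= d ->
  (forall y, `|h y - k y| <= d * y ^+ 2) ->
  forall x, `|step h x - step k x| <= d / 2 * x ^+ 2.
Proof.
move=> mh mk rh rk d0 hk x; have [xz|zx] := leP x z0.
  by rewrite /step xz subrr normr0 mulr_ge0 ?sqr_ge0// divr_ge0.
have x0 := lt_trans z0_gt0 zx.
rewrite !stepE// -mulrBl normrM [X in _ * X]gtr0_norm ?invr_gt0//.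
rewrite ler_pdivrMr//.
rewrite (_ : d / 2 * x ^+ 2 * x = d / 2 * x ^+ 3); last by ring.
exact: gain_contract (ltW x0).
Qed.

Definition iterate n := iter n step init_rate.

Lemma iterateP n : continuous (iterate n) /\ admissible (iterate n).
Proof.
elim: n => [|n [cn rn]].
  by split; [exact: init_rate_continuous|exact: admissible_init].
split; last exact: admissible_step.
exact: step_continuous (continuous_measurable_fun cn) rn.
Qed.

Lemma iterate_measurable n : measurable_fun setT (iterate n).
Proof. by have [cn _] := iterateP n; exact: continuous_measurable_fun. Qed.

(** The first two iterates agree on [[0, z0]] and are at distance at most
    [z0^-1] beyond it, where [z0^-1 <= z0 ^- 3 * x ^+ 2]. *)
Lemma iterate_dist n x :
  `|iterate n.+1 x - iterate n x| <= z0 ^- 3 * 2^-1 ^+ n * x ^+ 2.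
Proof.
elim: n x => [|n IHn] x.
  rewrite expr0 mulr1; have [xz|zx] := leP x z0.
    rewrite /iterate/= /step xz subrr normr0 mulr_ge0 ?sqr_ge0//.
    by rewrite invr_ge0 exprn_ge0// ltW.
  have x0 := lt_trans z0_gt0 zx.
  have [_ [i1 p1 l1]] := iterateP 1.
  have [i2 p2 l2] := admissible_init.
  have d1 : `|iterate 1 x - init_rate x| <= z0^-1.
    have a1 := admissible_le x (iterateP 1).2.
    have a2 := admissible_le x admissible_init.
    rewrite (ger0_norm (p1 x)) in a1; rewrite (ger0_norm (p2 x)) in a2.
    have q1 := p1 x; have q2 := p2 x.
    by rewrite ler_norml; apply/andP; split; lra.
  apply: (le_trans d1).
  have -> : z0 ^- 3 * x ^+ 2 = z0^-1 * (x / z0) ^+ 2.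
    by field; rewrite gt_eqF.
  rewrite ler_peMr ?invr_ge0 ?(ltW z0_gt0)//.
  by apply: exprn_ege1; rewrite ler_pdivlMr// mul1r ltW.
have -> : z0 ^- 3 * 2^-1 ^+ n.+1 * x ^+ 2 = (z0 ^- 3 * 2^-1 ^+ n) / 2 * x ^+ 2.
  by rewrite (exprS _ n); ring.
have [_ r1] := iterateP n; have [_ r2] := iterateP n.+1.
apply: (@step_contract (iterate n.+1) (iterate n)) => //.
- exact: iterate_measurable.
- exact: iterate_measurable.
- by rewrite mulr_ge0// ?invr_ge0 exprn_ge0// ltW.
Qed.

Lemma exists_fixed_point : exists h, [/\ continuous h, admissible h &
  forall x, 0 <= x -> x * h x = gain h x].
Proof.
have cv x : cvgn (iterate ^~ x).
  apply: (@geometric_cvg _ _ (z0 ^- 3 * x ^+ 2)) => n.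
  by apply: le_trans (iterate_dist n x) _; rewrite mulrAC.
pose h x := limn (iterate ^~ x).
have ch x : iterate ^~ x @ \oo --> h x by exact: cv.
have mh : measurable_fun setT h.
  apply: (@measurable_fun_cvg _ _ _ _ iterate) => // n.
  exact: iterate_measurable.
have rh : admissible h.
  split => x.
  - move=> xz; apply/cvg_lim => //.
    apply: (@cvg_near_eq _ _ _ _ (cst (init_rate x))).
      apply: nearW => n; have [_ [i1 _ _]] := iterateP n.
      by rewrite i1.
    exact: cvg_cst.
  - apply: (cvgr_to_ge (ch x)); apply: nearW => n.
    by have [_ []] := iterateP n.
  - apply: (cvgr_to_le (cvgM (cvg_cst x) (ch x))); apply: nearW => n.
    by have [_ [_ _ l]] := iterateP n; exact: l.
have cs y : surv (iterate n) y @[n --> \oo] --> surv h y.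
  apply: continuous_cvg; first exact: continuous_expR.
  apply: cvgN; apply: (@prim_cvg _ _ _ z0^-1) => //.
  - exact: iterate_measurable.
  - by move=> n t; have [_ /(admissible_le t)] := iterateP n.
have cg x : gain (iterate n) x @[n --> \oo] --> gain h x.
  apply: (@prim_cvg _ (fun n y => b y * dens (iterate n) y) _ z0^-1).
  - move=> n; have [_ rn] := iterateP n.
    exact: dens_measurable (iterate_measurable n) rn.
  - by move=> n y; have [_ /bdens_le] := iterateP n.
  - move=> y; apply: cvgM; first exact: cvg_cst.
    by apply: cvgM; [exact: cs|exact: ch].
have hE x : h x = step h x.
  have [xz|zx] := leP x z0; first by rewrite /step xz; case: rh => ->.
  have x0 := lt_trans z0_gt0 zx.
  rewrite stepE//; apply/cvg_lim => //.
  rewrite -(cvg_shiftS (iterate ^~ x)).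
  apply: (@cvg_near_eq _ _ _ _ (fun n => gain (iterate n) x / x)).
    apply: nearW => n; have [_ rn] := iterateP n.
    by rewrite -stepE.
  by apply: cvgM; [exact: cg|exact: cvg_cst].
exists h; split => //.
  by rewrite (_ : h = step h); [exact: step_continuous|exact/funext].
move=> x; rewrite le_eqVlt => /predU1P[<-|x0].
  by rewrite mul0r /gain prim_le0.
by rewrite hE stepE// mulrC divfK// gt_eqF.
Qed.

End fixed_point.

(** * Decay of the solution *)

Section pareto_tail.
Set Implicit Arguments.
Unset Strict Implicit.
Context {R : realType} (b : R -> R) (z0 : R).
Hypotheses (b_cont : continuous b) (b01 : forall x, 0 <= b x <= 1).
Hypotheses (z0_gt0 : 0 < z0) (b1 : forall x, 0 <= x <= z0 -> b x = 1).
Variable h : R -> R.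
Hypotheses (h_cont : continuous h) (h_adm : admissible z0 h).
Hypothesis h_fix : forall x, 0 <= x -> x * h x = gain b h x.

Notation mu := (@lebesgue_measure R).
Notation g := (gain b h).
Notation F := (surv h).
Notation phi := (dens h).
Implicit Types x y : R.

Lemma surv_cont : continuous F.
Proof. exact/surv_continuous/continuous_loc_int. Qed.

Lemma dens_cont : continuous phi.
Proof. by move=> x; apply: cvgM; [exact: surv_cont|exact: h_cont]. Qed.

Lemma bdens_cont : continuous (fun y => b y * phi y).
Proof. by move=> x; apply: cvgM; [exact: b_cont|exact: dens_cont]. Qed.

Lemma bdens_ge0 x : 0 <= b x * phi x.
Proof. by have /andP[b0 _] := b01 x; rewrite mulr_ge0// (dens_ge0 x h_adm). Qed.

Lemma gain_nondecreasing : {homo g : x y / x <= y}.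
Proof.
by apply: nondecreasing_prim => [|x _]; [exact: bdens_cont|exact: bdens_ge0].
Qed.

Lemma gain_ubound x : g x <= 1.
Proof.
have [x0|x0] := leP 0 x; first exact: (gain_le1 b_cont b01 z0_gt0 h_cont h_adm).
by rewrite /gain prim_le0// ltW.
Qed.

(** The limit at infinity of [gain b h], and the exponent of the decay of
    [surv h]. *)
Definition tail_exponent := sup (range g).

Lemma has_sup_gain : has_sup (range g).
Proof.
split; first by exists (g 0), 0.
by exists 1 => _ [x _ <-]; exact: gain_ubound.
Qed.

Lemma gain_le_tail_exponent x : g x <= tail_exponent.
Proof. by apply: ub_le_sup; [have [] := has_sup_gain|exists x]. Qed.

Lemma gain_ge_half x : z0 <= x -> 2^-1 <= g x.
Proof.
move=> zx; apply: le_trans (gain_nondecreasing zx).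
rewrite (admissible_gain z0_gt0 b1 h_adm); last by rewrite lexx ltW.
by rewrite ler_pdivlMr ?addr_gt0//; lra.
Qed.

Lemma tail_exponent_gt0 : 0 < tail_exponent.
Proof.
apply: lt_le_trans (gain_le_tail_exponent z0).
by apply: lt_le_trans (gain_ge_half (lexx _)); lra.
Qed.

(** The gain collects at most the mass that remains: after [x] it grows
    by [\int_x^y b phi <= \int_x^y phi = F x - F y]. *)
Lemma tail_exponent_le x : 0 <= x -> tail_exponent <= g x + F x.
Proof.
move=> x0; apply: ge_sup; first by have [] := has_sup_gain.
move=> _ [y _ <-]; have [yx|/ltW xy] := leP y x.
  apply: (le_trans (gain_nondecreasing yx)).
  by rewrite lerDl ltW// surv_gt0.
have y0 := le_trans x0 xy.
have lp : loc_int phi by apply: continuous_loc_int; exact: dens_cont.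
have lbp : loc_int (fun y => b y * phi y).
  by apply: continuous_loc_int; exact: bdens_cont.
have nd : {homo prim (fun t => phi t - b t * phi t) : x y / x <= y}.
  apply: nondecreasing_prim => [t|t _].
    by apply: cvgB; [exact: dens_cont|exact: bdens_cont].
  have /andP[_ bl] := b01 t.
  by rewrite subr_ge0 ler_piMl// (dens_ge0 t h_adm).
have := nd _ _ xy; rewrite !primB// !prim_dens//.
rewrite -/(g x) -/(g y); have := surv_gt0 h y.
by move: (F y) (F x) (g y) (g x) => {}*; lra.
Qed.

(** The logarithm of [F x / x `^ (- tail_exponent)]. *)
Definition logratio x := tail_exponent * ln x - prim h x.

(** By [h_fix], the derivative [h x] of [prim h] is [g x / x]. *)
Lemma is_derive_logratio x : 0 < x ->
  is_derive x 1 logratio ((tail_exponent - g x) / x).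
Proof.
move=> x0; have dP := is_derive_prim h_cont x0; have dl := is_derive1_ln x0.
rewrite /logratio; apply: is_derive_eq.
rewrite -(h_fix (ltW x0)) /GRing.scale/=; field.
by rewrite gt_eqF.
Qed.

Lemma logratio_nondecreasing x y : z0 <= x -> x <= y ->
  logratio x <= logratio y.
Proof.
apply: (is_derive_nondecreasing
  (df := fun x => (tail_exponent - g x) / x)) => t zt.
  exact/is_derive_logratio/(lt_le_trans z0_gt0).
rewrite divr_ge0 ?subr_ge0 ?gain_le_tail_exponent// ltW//.
exact: lt_le_trans zt.
Qed.

(** The growth of [logratio] is controlled by the decay of [F]: its slope
    is at most [F t / t], while [- F' t = F t * g t / t] is at least half of
    this beyond [z0]. *)
Lemma logratio_surv_nonincreasing x y : z0 <= x -> x <= y ->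
  logratio y + 2 * F y <= logratio x + 2 * F x.
Proof.
move=> zx xy; rewrite -lerN2.
apply: (@is_derive_nondecreasing R (fun t => - (logratio t + 2 * F t))
  (fun t => - ((tail_exponent - g t) / t + 2 * - phi t)) z0) => // t zt;
  have t0 := lt_le_trans z0_gt0 zt.
  have d1 := is_derive_logratio t0; have d2 := is_derive_surv h_cont t0.
  by apply: is_derive_eq; rewrite /GRing.scale/=; ring.
have -> : phi t = F t * g t / t.
  by rewrite -h_fix ?ltW// /dens; field; rewrite gt_eqF.
have -> : - ((tail_exponent - g t) / t + 2 * - (F t * g t / t)) =
   ((g t + F t - tail_exponent) + 2 * F t * (g t - 2^-1)) / t.
  by field; rewrite gt_eqF.
rewrite divr_ge0 ?(ltW t0)//; apply: addr_ge0.
  by rewrite subr_ge0 tail_exponent_le// ltW.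
by rewrite !mulr_ge0// ?subr_ge0 ?gain_ge_half// ltW// surv_gt0.
Qed.

Lemma logratio_ub x : z0 <= x -> logratio x <= logratio z0 + 2.
Proof.
move=> zx; have := logratio_surv_nonincreasing (lexx _) zx.
have := surv_gt0 h x; have := surv_le1 z0 h_adm.
move: (F x) (F z0) (logratio x) (logratio z0) => u v s t v1 u0 le_st; lra.
Qed.

Lemma logratio_cvg : exists l : R, logratio x @[x --> +oo] --> l.
Proof.
(* [logratio] is monotone only beyond [z0]: freeze it before. *)
pose f x := logratio (Num.max x z0).
have zm x : z0 <= Num.max x z0 by rewrite le_max lexx orbT.
exists (sup (range f)).
apply: (@cvg_near_eq _ _ _ _ f).
  near=> x; congr logratio; apply/max_idPl.
  by near: x; exact: nbhs_pinfty_ge (num_real _).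
apply: nondecreasing_cvgr.
  move=> x y xy; apply: logratio_nondecreasing => //.
  by rewrite ge_max !le_max xy lexx !orbT.
by exists (logratio z0 + 2) => _ [x _ <-]; exact: logratio_ub.
Unshelve. all: by end_near. Qed.

Lemma surv_logratio x : 0 < x ->
  F x / x `^ (- tail_exponent) = expR (logratio x).
Proof.
move=> x0; rewrite powRN invrK /powR gt_eqF// -expRD; congr expR.
by rewrite addrC.
Qed.

Lemma surv_tail : exists k : R, 0 < k /\
  F x / x `^ (- tail_exponent) @[x --> +oo] --> k.
Proof.
have [l Ll] := logratio_cvg; exists (expR l); split; first exact: expR_gt0.
apply: (@cvg_near_eq _ _ _ _ (expR \o logratio)).
  by near=> x; rewrite surv_logratio.
by apply: continuous_cvg => //; exact: continuous_expR.
Unshelve. all: by end_near. Qed.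

(** [logratio] is bounded above, so [F x] is at most a constant times
    [x `^ (- tail_exponent)]. *)
Lemma surv_cvg0 : F x @[x --> +oo] --> 0.
Proof.
apply/cvgr0Pnorm_le => e e0.
(* [c] is the value of [ln x] from which the upper bound for [ln (F x)],
   namely [logratio z0 + 2 - tail_exponent * ln x], is at most [ln e]. *)
pose c := (logratio z0 + 2 - ln e) / tail_exponent.
near=> x.
have zx : z0 <= x by near: x; exact: nbhs_pinfty_ge (num_real _).
have x0 := lt_le_trans z0_gt0 zx.
have cx : expR c <= x by near: x; exact: nbhs_pinfty_ge (num_real _).
have cl : c <= ln x by rewrite -ler_expR lnK.
rewrite gtr0_norm ?surv_gt0//.
rewrite -[leRHS](@lnK _ e)// /surv ler_expR.
have := logratio_ub zx; rewrite /logratio => ub.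
move: cl; rewrite /c ler_pdivrMr ?tail_exponent_gt0// mulrC.
rewrite /logratio in ub *; lra.
Unshelve. all: by end_near. Qed.

Lemma integral_dens_itvy x : 0 <= x ->
  (\int[mu]_(y in `[x, +oo[) (phi y)%:E)%E = (F x)%:E.
Proof.
move=> x0; rewrite (@ge0_continuous_FTC2y R phi (- F) x 0).
- by rewrite sub0e -EFinN /= opprK.
- by move=> y _; exact: dens_ge0 h_adm.
- by apply: continuous_subspaceT; exact: dens_cont.
- by rewrite -[X in _ --> X]oppr0; apply: cvgN; exact: surv_cvg0.
- move=> y xy; have d := is_derive_surv h_cont (le_lt_trans x0 xy).
  by apply: ex_derive.
- by apply: cvg_at_right_filter; apply: cvgN; exact: surv_cont.
- move=> y; rewrite in_itv/= andbT => xy.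
  have d := is_derive_surv h_cont (le_lt_trans x0 xy).
  by rewrite derive1E derive_val opprK.
Qed.

Lemma Rintegral_dens_itvy x : 0 <= x -> \int[mu]_(y in `[x, +oo[) phi y = F x.
Proof. by move=> x0; rewrite /Rintegral integral_dens_itvy. Qed.

Lemma dens_integrable : integrable_on `[0, +oo[ phi.
Proof.
apply/integrableP; split.
  apply/measurable_EFinP; apply: measurable_funTS.
  exact: continuous_measurable_fun dens_cont.
under eq_integral do rewrite /= ger0_norm ?(dens_ge0 _ h_adm)//.
by rewrite integral_dens_itvy// ltry.
Qed.

Lemma dens_pareto : has_pareto_tail phi.
Proof.
have [k [k0 Fk]] := surv_tail; exists k, tail_exponent^-1; split => //.
  by rewrite invr_gt0 tail_exponent_gt0.
rewrite invrK; apply: cvg_near_eq Fk.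
by near=> x; rewrite Rintegral_dens_itvy.
Unshelve. all: by end_near. Qed.

(** At 0 this is the derivative of [z0 / (x + z0) ^+ 2]; elsewhere the
    derivative of [F g / x] in which [F g] has been replaced by [x phi]. *)
Definition ddens x : R := if x == 0 then - 2 / z0 ^+ 2
  else (b x * phi x * F x - phi x * g x - phi x) / x.

Lemma dens_diff_quotient x : 0 <= x ->
  diff_quotient phi x y @[y --> within `[0, +oo[%classic x^'] --> ddens x.
Proof.
rewrite /ddens le_eqVlt => /predU1P[<-|x0].
  rewrite eqxx; apply: (@cvg_diff_quotient _ _ _ (fun y => z0 / (y + z0) ^+ 2)).
  - have nz : (0 + z0) ^+ 2 != 0 by rewrite expf_neq0// add0r gt_eqF.
    apply: is_derive_eq; rewrite /GRing.scale/=; field.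
    by rewrite gt_eqF.
  - by rewrite (admissible_dens z0_gt0 h_adm)// lexx ltW.
  - near=> y; rewrite /= in_itv/= andbT => y0.
    rewrite (admissible_dens z0_gt0 h_adm)// y0/= ltW//.
    by near: y; exact: lt_nbhsl.
rewrite gt_eqF//.
apply: (@cvg_diff_quotient _ _ _ (fun y => F y * g y / y)).
- have d1 := is_derive_surv h_cont x0.
  have d2 : is_derive x 1 g (b x * phi x).
    exact: is_derive_prim bdens_cont x0.
  have nz : x != 0 by rewrite gt_eqF.
  have d3 : is_derive x 1 (fun y : R => y^-1) (- x ^- 2 *: 1).
    exact: (@is_deriveV _ id x 1 1 nz).
  have d4 : is_derive x 1 (fun y => F y * g y)
      (F x *: (b x * phi x) + g x *: - phi x).
    exact: is_deriveM.
  apply: (@is_derive_eq _ _ _ _ _ _ _ _ (is_deriveM d4 d3)).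
  rewrite /GRing.scale/= -(h_fix (ltW x0)) /dens; field.
  exact: nz.
- by rewrite -h_fix ?ltW// /dens; field; rewrite gt_eqF.
- near=> y => _; have y0 : 0 < y by near: y; exact: lt_nbhsr.
  by rewrite -h_fix ?ltW// /dens; field; rewrite gt_eqF.
Unshelve. all: by end_near. Qed.

Lemma dens_derive_on x : 0 <= x ->
  derivable_on `[0, +oo[ phi x /\ derive_on `[0, +oo[ phi x = ddens x.
Proof.
move=> x0; have dq := dens_diff_quotient x0.
have pf : ProperFilter (within (`[0, +oo[%classic : set R) x^').
  apply: within_punctured_proper => e e0; exists (x + e / 2); split.
  - by rewrite /= in_itv/= andbT addr_ge0// divr_ge0// ltW.
  - by rewrite gt_eqF// ltrDl divr_gt0.
  - by rewrite addrC addKr gtr0_norm ?divr_gt0//; lra.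
split; first by apply/cvg_ex; exists (ddens x).
exact/cvg_lim.
Qed.

(** At [x = 0] both sides equal [- gamma * phi 0], since [F 0 = b 0 = 1];
    elsewhere [ddens] was computed so that the equation becomes an identity. *)
Lemma dens_solution (alpha sigma : R -> R) (gamma : R) : 0 < gamma ->
  (forall x, 0 <= x -> alpha (sigma x) = gamma * b x) ->
  is_solution alpha sigma gamma phi.
Proof.
move=> gamma0 alb x x0; have [dphi ->] := dens_derive_on x0; split => //.
rewrite Rintegral_dens_itvy// alb//.
have -> : \int[mu]_(y in `[0, x]) (alpha (sigma y) * phi y) = gamma * g x.
  rewrite -[RHS]primZ; last by apply: continuous_loc_int; exact: bdens_cont.
  by apply: eq_prim => y /andP[y0 _]; rewrite alb// mulrA.
rewrite /ddens; case: ifPn => [/eqP->|xn0].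
  rewrite surv0 /gain prim_le0// b1 ?lexx ?ltW//; ring.
by field.
Qed.

End pareto_tail.

(** * The theorem *)

Theorem theorem4p5 (R : realType) (alpha sigma : R -> R) (z0 : R)
  (alpha_ge0 : forall s, 0 <= s <= 1 -> 0 <= alpha s)
  (alpha_cont : {within `[0, 1], continuous alpha})
  (alpha_smooth : smooth_on `]0, 1] alpha)
  (alpha_mono : monotone_on `[0, 1] alpha)
  (alpha0 : alpha 0 = 0)
  (dalpha0 : derive_on `]0, 1] alpha s @[s --> 0^'+] --> +oo)
  (ddalpha_lt0 : forall s, 0 < s <= 1 ->
     derive_on `]0, 1] (derive_on `]0, 1] alpha) s < 0)
  (sigma_C1 : C1_on `[0, +oo[ sigma)
  (sigma01 : forall z, 0 <= z -> 0 <= sigma z <= 1)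
  (z0_gt0 : 0 < z0)
  (sigma_eq1 : forall z, 0 <= z <= z0 -> sigma z = 1)
  (dsigma_le0 : forall z, 0 <= z -> derive_on `[0, +oo[ sigma z <= 0) :
  exists (gamma : R) (phi : R -> R),
    [/\ 0 < gamma,
        integrable_on `[0, +oo[ phi,
        is_solution alpha sigma gamma phi &
        has_pareto_tail phi].
Proof.
have [al1_gt0 al_le] := alpha1_gt0 alpha_ge0 alpha_mono alpha0 dalpha0.
have max_ge0 (x : R) : 0 <= Num.max x 0 by rewrite le_max lexx orbT.
(* Freezing the coefficient to the left of 0 makes it continuous on the line. *)
pose b x := alpha (sigma (Num.max x 0)) / alpha 1.
have b_cont : continuous b.
  move=> x; apply: cvgM; last exact: cvg_cst.
  apply: (@continuous_comp_within _ _ alpha (sigma \o (fun x => Num.max x 0))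
    alpha_cont) => [|{}x]; last by rewrite /= in_itv/= sigma01.
  apply: (@continuous_comp_within _ `[0, +oo[) => [||{}x].
  - apply/subspace_continuousP => y y0; apply: derivable_on_continuous.
    exact: sigma_C1.1.
  - move=> y; apply: (@continuous_max _ _ id (cst 0)).
      exact: cvg_id.
    exact: cvg_cst.
  - by rewrite /= in_itv/= andbT.
have b01 x : 0 <= b x <= 1.
  have sx := sigma01 _ (max_ge0 x).
  by rewrite divr_ge0 ?alpha_ge0 ?ler01 ?lexx//= ler_pdivrMr// mul1r al_le.
have b1 x : 0 <= x <= z0 -> b x = 1.
  move=> /andP[x0 xz]; rewrite /b (max_idPl x0) sigma_eq1 ?x0//.
  by rewrite divff// gt_eqF.
have [h [h_cont h_adm h_fix]] := exists_fixed_point b_cont b01 z0_gt0 b1.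
exists (alpha 1), (dens h); split => //.
- exact: (@dens_integrable _ b z0).
- apply: (@dens_solution _ b z0) => // x x0.
  by rewrite /b (max_idPl x0) mulrC divfK// gt_eqF.
- exact: (@dens_pareto _ b z0).
Qed.
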